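(* Let $n\ge 1$, let $\mathcal X_1,\dots,\mathcal X_n$ be sets, and for each $i$ let $\Pi_i$ be a possibility measure on $\mathcal X_i$ with possibility distribution $\pi_i$ whose range is $\pi_i(\mathcal X_i)=[0,1]$. Let $\Omega=\mathcal X_1\times\dots\times\mathcal X_n$ be equipped with the total preorder $\preceq$ defined by $x\preceq y$ iff $Z(x)\le Z(y)$, where $Z(x_1,\dots,x_n)=\max_{i=1}^n\pi_i(x_i)$. Then the possibility distribution on $\Omega$ given by $$\pi(x)=\Bigl(\max_{i=1}^n\pi_i(x_i)\Bigr)^n$$ induces the least conservative upper cumulative distribution function on $(\Omega,\preceq)$ that dominates the independent natural extension $\bigotimes_{i=1}^n\Pi_i$ of $\Pi_1,\dots,\Pi_n$. That is: $\pi$ is a possibility distribution, and the function $\overline F(x)=\sup_{y\preceq x}\pi(y)$ is the pointwise smallest among all cumulative distribution functions on $(\Omega,\preceq)$ that dominate $\bigotimes_{i=1}^n\Pi_i$.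
   Context: A possibility distribution on a set is a $[0,1]$-valued map $\pi$ with supremum $1$; its possibility measure is $\Pi(A)=\sup_{x\in A}\pi(x)$ for every subset $A$ (with $\sup\emptyset=0$). A cumulative distribution function on a totally preordered space $(\Omega,\preceq)$ with smallest element $0_\Omega$ and largest element $1_\Omega$ is a non-decreasing map $F:\Omega\to[0,1]$ with $F(1_\Omega)=1$. It is said to dominate an upper probability $Q$ (defined on all subsets of $\Omega$) if $\overline E_F(A)\ge Q(A)$ for all $A\subseteq\Omega$, where $\overline E_F(A)$ is the supremum of $P(A)$ over all finitely additive probabilities $P$ on the power set of $\Omega$ satisfying $P([0_\Omega,x])\le F(x)$ for all $x\in\Omega$, with $[0_\Omega,x]=\{z:z\preceq x\}$ (this is the natural extension of the p-box with vacuous lower cumulative distribution function and upper cumulative distribution function $F$). Independent natural extension (the most conservative joint model under epistemic independence): for a bounded function $g$ on $\mathcal X_i$ let $\overline P_i(g)=\sup P(g)$, the supremum of the expectations of $g$ over all finitely additive probabilities $P$ on $\mathcal X_i$ with $P(A)\le\Pi_i(A)$ for all $A\subseteq\mathcal X_i$. Then, for $A\subseteq\Omega$, $$\Bigl(\bigotimes_{i=1}^n\Pi_i\Bigr)(A)=\inf_{h_1,\dots,h_n}\ \sup_{z\in\Omega}\Bigl[I_A(z)-\sum_{i=1}^n\bigl(h_i(z)-\overline P_i(h_i(\cdot,z_{-i}))\bigr)\Bigr],$$ where $h_1,\dots,h_n$ range over bounded real functions on $\Omega$, $z_{-i}$ denotes the coordinates of $z$ other than the $i$-th, and $h_i(\cdot,z_{-i})$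 is the function on $\mathcal X_i$ obtained by fixing them. It is a coherent upper probability (the upper envelope, on events, of a nonempty set of finitely additive probabilities), and it satisfies the known factorization property $\bigl(\bigotimes_{i=1}^n\Pi_i\bigr)\bigl(\prod_{i=1}^nA_i\bigr)=\prod_{i=1}^n\Pi_i(A_i)$ for all $A_i\subseteq\mathcal X_i$. *)

(* Defs.v *)
From HB Require Import structures.
From mathcomp Require Import all_boot all_order all_algebra.
From mathcomp Require Import all_classical all_reals all_analysis.

Set Implicit Arguments.
Unset Strict Implicit.
Unset Printing Implicit Defensive.

Import Order.TTheory GRing.Theory Num.Theory.
Import numFieldNormedType.Exports.

Local Open Scope classical_set_scope.
Local Open Scope ring_scope.

(** [sup] and [inf] are real-valued, with [sup set0 = 0]. Apart from
    [sup set0], no default value is relied upon: for possibility measures,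
    cumulative distribution functions and bounded functions, the suprema and
    infima below are over nonempty sets bounded on the relevant side. *)

Section Possibility.
Context {R : realType} {T : Type}.
Implicit Types (pi F : T -> R) (A : set T) (le : rel T).

Definition possibility_distribution pi : Prop :=
  (forall x, 0 <= pi x <= 1) /\ sup (range pi) = 1.

Definition possibility_measure pi A : R := sup (pi @` A).

Record finadd_probability (P : set T -> R) : Prop := FinaddProbability {
  finadd_ge0 : forall A, 0 <= P A;
  finadd_setT : P setT = 1;
  finadd_additive :
    forall A B, A `&` B = set0 -> P (A `|` B) = P A + P B }.

(** Dunford integral, through lower sums: a simple function is presented by a
    finite partition [k] of [T], some blocks of which may be empty, and one
    value [c j] on each block. For bounded [g] the lower and upper integrals
    coincide. *)
Definition finadd_expectation (P : set T -> R) (g : T -> R) : R :=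
  sup [set r : R | exists (m : nat) (k : T -> 'I_m) (c : 'I_m -> R),
    (forall x, c (k x) <= g x) /\ r = \sum_(j < m) c j * P (k @^-1` [set j])].

Definition upper_expectation (Q : set T -> R) (g : T -> R) : R :=
  sup [set finadd_expectation P g | P in
        [set P | finadd_probability P /\ forall A, P A <= Q A]].

(** In a total preorder the largest element is unique only up to equivalence;
    since [F] is non-decreasing and at most [1], the choice of [t] does not
    matter. *)
Definition is_cdf le F : Prop :=
  [/\ forall x, 0 <= F x <= 1,
      forall x y, le x y -> F x <= F y
    & exists2 t, (forall x, le x t) & F t = 1].

(** [[set z | le z x]] is the interval from the smallest element to [x]. *)
Definition pbox_upper le F A : R :=
  sup [set P A | P in [set P : set T -> R | finadd_probability P /\
                         forall x, P [set z | le z x] <= F x]].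

Definition dominates le F (Q : set T -> R) : Prop :=
  forall A, Q A <= pbox_upper le F A.

Definition induced_cdf le pi (x : T) : R :=
  possibility_measure pi [set y | le y x].

End Possibility.

Section Product.
Context {R : realType} {n : nat} {X : 'I_n -> Type}.

Let Omega := forall i, X i.

(** [dfwith z i a] is [z] with its [i]-th coordinate replaced by [a : X i], so
    [fun a => h i (dfwith z i a)] is [h_i(., z_{-i})]. *)
Definition indep_natural_extension (Q : forall i, set (X i) -> R)
    (A : set Omega) : R :=
  inf [set sup [set \1_A z - \sum_(i < n)
          (h i z - upper_expectation (Q i) (fun a : X i => h i (dfwith z i a)))
        | z in [set: Omega]]
      | h in [set h : 'I_n -> Omega -> R | forall i, bounded_fun (h i)]].

(** Starting the maximum at [0] is harmless: the [pi i] are nonnegative. *)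
Definition maxposs (pi : forall i, X i -> R) (x : Omega) : R :=
  \big[Num.max/0]_(i < n) pi i (x i).

Definition maxposs_le (pi : forall i, X i -> R) : rel Omega :=
  fun x y => maxposs pi x <= maxposs pi y.

Lemma maxposs_le_total pi : total (maxposs_le pi).
Proof. by move=> x y; exact: le_total. Qed.

Lemma maxposs_le_trans pi : transitive (maxposs_le pi).
Proof. by move=> y x z; exact: le_trans. Qed.

Lemma maxposs_le_smallest_largest (pi : forall i, X i -> R) :
  (forall i, range (pi i) = [set` `[0, 1]]) ->
  exists b t, forall x, maxposs_le pi b x /\ maxposs_le pi x t.
Proof.
move=> rpi.
have pick r (r01 : 0 <= r <= 1) i : {a : X i | pi i a = r}.
  apply: cid; have : range (pi i) r by rewrite rpi /= in_itv.
  by move=> [a _ <-]; exists a.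
have i0 : 0 <= (0 : R) <= 1 by rewrite lexx ler01.
have i1 : 0 <= (1 : R) <= 1 by rewrite lexx ler01.
exists (fun i => sval (pick _ i0 i)), (fun i => sval (pick _ i1 i)) => x.
have x01 i : 0 <= pi i (x i) <= 1.
  have : range (pi i) (pi i (x i)) by exists (x i).
  by rewrite rpi /= in_itv.
split; apply: le_bigmax2 => i _; have /andP[x0 x1] := x01 i;
  by rewrite (svalP (pick _ _ i)).
Qed.

End Product.

(* Main.v *)
(** Write [E] for the independent natural extension and [Z] for the maximum of
    the [pi_ i]. Sublevel sets of [Z] are products of sublevel sets of the
    [pi_ i], and [E] takes the value [s ^+ n] on [Z <= s].
    - Upper bound: let [h_i] be [s ^+ (n - i)] times the indicator of
      [pi_j (z_j) <= s] for all [j <= i] (counting from 1); the upper expectation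
      of [h_i] in its [i]-th coordinate is at most [h_(i-1)], and the sum in the
      definition of [E] telescopes.
    - Lower bound: pick [a_i], [b_i] with [pi_i a_i = s] and [pi_i b_i = 1]. The
      two-point law with mass [s] at [a_i] and [1 - s] at [b_i] lies below
      [Pi_i]. Averaging over the product of these laws cancels the sum, so some
      of the [2 ^ n] points in its support witnesses the value [s ^+ n],
      whatever the [h_i].
    The lower bound makes any dominating [G] at least [Z x ^+ n] at [x]. For
    dominance, the law with mass [Z a ^+ n] at [a] and the rest at a point where
    [Z = 1] respects the p-box, so [Z <= s] on [A], where [s] is the [n]-th root
    of the p-box value of [A]; the upper bound applied to that [s] concludes. *)

Require Import Defs.
From mathcomp Require Import all_boot all_order all_algebra.
From mathcomp Require Import all_classical all_reals all_analysis.
From mathcomp Require Import ring lra.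

Import Order.TTheory GRing.Theory Num.Theory.
Import numFieldNormedType.Exports.

Local Open Scope classical_set_scope.
Local Open Scope ring_scope.

(** * Suprema and bounded functions *)

Lemma sup_le_nneg {R : realType} (S : set R) (M : R) :
  0 <= M -> ubound S M -> sup S <= M.
Proof.
(* The empty set has supremum 0, which is where [0 <= M] enters. *)
move=> M0 SM; have [->|/set0P S0] := eqVneq S set0; first by rewrite sup0.
exact: ge_sup.
Qed.

Lemma le_sup_mem {R : realType} (S : set R) (M r : R) :
  ubound S M -> S r -> r <= sup S.
Proof. by move=> SM; apply: ub_le_sup; exists M. Qed.

(** Outside its domain [sup] takes the value 0, so empty or unbounded sets obey the bound too. *)
Lemma sup_nneg {R : realType} (S : set R) :
  (forall r, S r -> 0 <= r) -> 0 <= sup S.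
Proof.
move=> S0; have [supS|/sup_out -> //] := pselect (has_sup S).
by have [[r Sr] _] := supS; rewrite (le_trans (S0 r Sr))// sup_upper_bound.
Qed.

Lemma bounded_funP {R : realType} {T : Type} (f : T -> R) :
  bounded_fun f <-> exists2 M, 0 <= M & forall x, `|f x| <= M.
Proof.
split=> [[M [_ fM]]|[M M0 fM]].
  exists (`|M| + 1) => [|x]; first by rewrite addr_ge0.
  by apply: fM => //; rewrite (le_lt_trans (ler_norm M))// ltrDl.
exists M; split; first exact: num_real.
by move=> N MN x _; exact: le_trans (fM x) (ltW MN).
Qed.

(** * Finitely additive probabilities and their expectations *)

Lemma finadd_set0 {R : realType} {T : Type} {P : set T -> R} :
  finadd_probability P -> P set0 = 0.
Proof.
move=> fP; have := finadd_additive fP (setI0 (@set0 T)).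
by rewrite setU0 => /eqP; rewrite -subr_eq subrr => /eqP.
Qed.

Lemma finadd_setIC {R : realType} {T : Type} {P : set T -> R} (A B : set T) :
  finadd_probability P -> P A = P (A `&` B) + P (A `&` ~` B).
Proof.
move=> fP; rewrite -(finadd_additive fP); first by rewrite -setIUr setUv setIT.
by rewrite setIACA setICr setI0.
Qed.

Lemma finadd_le {R : realType} {T : Type} {P : set T -> R} (A B : set T) :
  finadd_probability P -> A `<=` B -> P A <= P B.
Proof.
move=> fP /setIidr AB; rewrite (finadd_setIC B A fP) AB lerDl.
exact: finadd_ge0.
Qed.

Lemma finadd_le1 {R : realType} {T : Type} {P : set T -> R} (A : set T) :
  finadd_probability P -> P A <= 1.
Proof. by move=> fP; rewrite -(finadd_setT fP); apply: finadd_le. Qed.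

Lemma finadd_bigsetU {R : realType} {T : Type} {P : set T -> R} {m : nat}
    (B : 'I_m -> set T) :
  finadd_probability P -> (forall i j x, B i x -> B j x -> i = j) ->
  P [set x | exists j, B j x] = \sum_(j < m) P (B j).
Proof.
move=> fP; elim: m B => [|m IH] B disB.
  rewrite big_ord0 -(finadd_set0 fP); congr P.
  by apply/seteqP; split=> x // [[]].
rewrite big_ord_recl -IH => [|i j x Bi Bj]; last first.
  by apply: (@lift_inj _ ord0); exact: disB Bi Bj.
rewrite -(finadd_additive fP); last first.
  by apply/seteqP; split=> x // [B0 [j Bj]]; have := disB _ _ _ B0 Bj.
congr P; apply/seteqP; split=> x /=.
  move=> [j]; case: (unliftP ord0 j) => [j' ->|->] Bj; last by left.
  by right; exists j'.
by move=> [B0|[j Bj]]; [exists ord0|exists (lift ord0 j)].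
Qed.

(** Cut each block of a lower sum along [A]. An empty piece has mass 0; a point of a nonempty piece
    bounds the value on the block by [c] inside [A] and by 0 outside. *)
Lemma finadd_expectation_le {R : realType} {T : Type} (P : set T -> R)
    (A : set T) (g : T -> R) (c : R) :
  finadd_probability P -> 0 <= c -> (forall x, A x -> g x <= c) ->
  (forall x, ~ A x -> g x <= 0) -> finadd_expectation P g <= c * P A.
Proof.
move=> fP c0 gA gNA; apply: sup_le_nneg.
  by rewrite mulr_ge0// finadd_ge0.
move=> _ [m [k [b [bg ->]]]].
have -> : P A = \sum_(j < m) P (k @^-1` [set j] `&` A).
  rewrite -finadd_bigsetU//; last by move=> i j x [<- _] [<- _].
  by congr P; apply/seteqP; split=> [x Ax|x [j []]//]; exists (k x).
rewrite mulr_sumr; apply: ler_sum => j _.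
rewrite (finadd_setIC (k @^-1` [set j]) A fP) mulrDr -[leRHS]addr0.
have bound (B : set T) (d : R) : (forall x, B x -> k x = j -> g x <= d) ->
    b j * P (k @^-1` [set j] `&` B) <= d * P (k @^-1` [set j] `&` B).
  move=> gB; have [->|/set0P [x [/= kx Bx]]] :=
    eqVneq (k @^-1` [set j] `&` B) set0.
    by rewrite (finadd_set0 fP) !mulr0.
  apply: ler_wpM2r; first exact: finadd_ge0.
  by rewrite -kx (le_trans (bg x))// gB.
apply: lerD; first by apply: bound => x Ax _; exact: gA.
rewrite -[leRHS](mul0r (P (k @^-1` [set j] `&` ~` A))).
by apply: bound => x Ax _; exact: gNA.
Qed.

Lemma upper_expectation_le {R : realType} {T : Type} (Q : set T -> R)
    (A : set T) (g : T -> R) (c q : R) :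
  0 <= c -> 0 <= q -> Q A <= q -> (forall x, A x -> g x <= c) ->
  (forall x, ~ A x -> g x <= 0) -> upper_expectation Q g <= c * q.
Proof.
move=> c0 q0 QA gA gNA; apply: sup_le_nneg; first exact: mulr_ge0.
move=> _ [P [fP PQ] <-].
apply: (le_trans (finadd_expectation_le P A g c fP c0 gA gNA)).
by rewrite ler_wpM2l// (le_trans (PQ A)).
Qed.

(** * Two-point laws *)

Definition two_point {R : realType} {T : Type} (s : R) (a b : T)
    (A : set T) : R :=
  s * \1_A a + (1 - s) * \1_A b.

Lemma two_point_finadd {R : realType} {T : Type} (s : R) (a b : T) :
  0 <= s <= 1 -> finadd_probability (two_point s a b).
Proof.
move=> /andP[s0 s1]; split=> [A||A B AB].
- by rewrite addr_ge0// mulr_ge0 ?subr_ge0// indicE ler0n.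
- by rewrite /two_point !indicE !in_setT !mulr1 addrC subrK.
- rewrite /two_point.
  have E x : \1_(A `|` B) x = \1_A x + \1_B x :> R.
    rewrite !indicE in_setU.
    have [Ax|nAx] := boolP (x \in A); last by rewrite add0r.
    have [Bx|_] := boolP (x \in B); last by rewrite addr0.
    by have : (A `&` B) x; [split; exact: set_mem|rewrite AB].
  by rewrite !E; ring.
Qed.

Lemma two_point_lower_sum {R : realType} {T : Type} (s : R) (a b : T) (m : nat)
    (k : T -> 'I_m) (c : 'I_m -> R) :
  \sum_(j < m) c j * two_point s a b (k @^-1` [set j]) =
  s * c (k a) + (1 - s) * c (k b).
Proof.
have E x : \sum_(j < m) c j * \1_(k @^-1` [set j]) x = c (k x).
  rewrite (bigD1 (k x))//= big1 => [|j jx]; rewrite indicE.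
    by rewrite mem_set// mulr1 addr0.
  by rewrite memNset ?mulr0// => /= E; rewrite E eqxx in jx.
rewrite -!E !mulr_sumr -big_split/=; apply: eq_bigr => j _.
by rewrite /two_point; ring.
Qed.

Lemma upper_expectation_two_point {R : realType} {T : Type} (Q : set T -> R)
    (s M : R) (a b : T) (g : T -> R) :
  0 <= s <= 1 -> (forall A, two_point s a b A <= Q A) ->
  (forall x, `|g x| <= M) ->
  s * g a + (1 - s) * g b <= upper_expectation Q g.
Proof.
move=> s01 PQ gM; have fP := two_point_finadd s a b s01.
have M0 : 0 <= M := le_trans (normr_ge0 _) (gM a).
have expM P : finadd_probability P -> finadd_expectation P g <= M.
  move=> fP'; rewrite -[leRHS]mulr1 -(finadd_setT fP').
  apply: finadd_expectation_le => // x; last by move=> /(_ I).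
  by move=> _; exact: le_trans (ler_norm _) (gM x).
apply: (@le_trans _ _ (finadd_expectation (two_point s a b) g)); last first.
  rewrite /upper_expectation; apply: (le_sup_mem _ M).
    by move=> _ [P [fP' _] <-]; exact: expM.
  by exists (two_point s a b).
have /andP[s0 s1] := s01.
rewrite /finadd_expectation; apply: (le_sup_mem _ (s * g a + (1 - s) * g b)).
  move=> _ [m [k [c [cg ->]]]]; rewrite two_point_lower_sum.
  by rewrite lerD// ler_wpM2l// subr_ge0.
(* A lower sum attaining the two-point average: blocks for [a], for [b] and for the rest, where
   [- M] minorizes [g]. If [a = b], the first block takes both masses. *)
pose k x : 'I_3 :=
  if pselect (x = a) then 0 else if pselect (x = b) then 1 else 2%:R.
pose c (j : 'I_3) := if j == 0 then g a else if j == 1 then g b else - M.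
have ckx x : c (k x) = if pselect (x = a) then g a else
                if pselect (x = b) then g b else - M.
  rewrite /c /k; case: (pselect (x = a)) => [xa|xa] //.
  by case: (pselect (x = b)) => xb.
exists 3, k, c; split=> [x|].
  rewrite ckx; case: (pselect (x = a)) => [xa|xa] /=; first by rewrite xa.
  case: (pselect (x = b)) => [xb|xb] /=; first by rewrite xb.
  by rewrite lerNl (le_trans _ (gM x))// -normrN ler_norm.
rewrite two_point_lower_sum !ckx; case: (pselect (a = a)) => [aa|//] /=.
case: (pselect (b = a)) => [ba|ba] /=; first by rewrite ba.
by case: (pselect (b = b)) => bb.
Qed.

(** A set containing [b] has possibility 1; any other set carries at most the mass [p a], and only
    if it contains [a]. *)
Lemma two_point_poss {R : realType} {T : Type} (p : T -> R) (a b : T)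
    (A : set T) :
  (forall x, 0 <= p x <= 1) -> p b = 1 ->
  two_point (p a) a b A <= possibility_measure p A.
Proof.
move=> p01 pb.
have ge x : A x -> p x <= possibility_measure p A.
  move=> Ax; apply: (le_sup_mem (p @` A) 1); last by exists x.
  by move=> _ [y _ <-]; case/andP: (p01 y).
rewrite /two_point !indicE.
have /andP[pa0 pa1] := p01 a.
have [bA|bA] := boolP (b \in A).
  apply: (@le_trans _ _ 1); last by rewrite -pb ge//; exact: set_mem.
  by case: (a \in A); rewrite /=; lra.
have [aA|aA] := boolP (a \in A) => /=.
  by rewrite mulr1 mulr0 addr0 ge//; exact: set_mem.
rewrite !mulr0 addr0.
by apply: sup_nneg => _ [y _ <-]; case/andP: (p01 y).
Qed.

(** * Product of Bernoulli laws on Boolean configurations *)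

Definition upd {I : finType} (f : {ffun I -> bool}) (i : I) (v : bool) :
  {ffun I -> bool} := [ffun j => if j == i then v else f j].

Definition bernoulli_weight {R : realType} {I : finType} (s : R)
    (f : {ffun I -> bool}) : R :=
  \prod_i (if f i then s else 1 - s).

Lemma bernoulli_weight_ge0 {R : realType} {I : finType} (s : R)
    (f : {ffun I -> bool}) : 0 <= s <= 1 -> 0 <= bernoulli_weight s f.
Proof.
move=> /andP[s0 s1]; apply: prodr_ge0 => i _.
by case: ifP => // _; rewrite subr_ge0.
Qed.

Lemma sum_bernoulli_weight {R : realType} (I : finType) (s : R) :
  \sum_(f : {ffun I -> bool}) bernoulli_weight s f = 1.
Proof.
rewrite -(bigA_distr_bigA (fun (_ : I) (v : bool) => if v then s else 1 - s)).
by rewrite big1// => i _; rewrite big_bool/= addrC subrK.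
Qed.

(** Resampling one coordinate from its own law preserves the product law. This is what cancels the
    [h_i] in the lower bound. *)
Lemma sum_bernoulli_weight_upd {R : realType} {I : finType} (s : R) (i : I)
    (H : {ffun I -> bool} -> R) :
  \sum_f bernoulli_weight s f *
    (s * H (upd f i true) + (1 - s) * H (upd f i false)) =
  \sum_f bernoulli_weight s f * H f.
Proof.
have updK f u v : upd (upd f i u) i v = upd f i v.
  by apply/ffunP => j; rewrite !ffunE; case: (j == i).
have upd_id (f : {ffun I -> bool}) v : f i = v -> upd f i v = f.
  by move=> <-; apply/ffunP => j; rewrite !ffunE; case: eqP => // ->.
(* Pair each configuration having [true] at [i] with the one differing from it only at [i]. *)
have split_sum (G : {ffun I -> bool} -> R) :
    \sum_f G f = \sum_(f : {ffun I -> bool} | f i) (G f + G (upd f i false)).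
  rewrite (bigID (fun f : {ffun I -> bool} => f i))/= big_split/=; congr (_ + _).
  rewrite (reindex_onto (fun f => upd f i false) (fun f => upd f i true)) => [|f].
    apply: eq_bigl => f; rewrite ffunE eqxx updK/=.
    apply/eqP/idP => [<-|fi]; first by rewrite ffunE eqxx.
    exact: upd_id.
  by move=> /negbTE fi; rewrite updK upd_id.
rewrite !split_sum; apply: eq_bigr => f fi; rewrite !updK (upd_id f true)//.
pose W := \prod_(j | j != i) (if f j then s else 1 - s).
have -> : bernoulli_weight s f = s * W.
  by rewrite /bernoulli_weight (bigD1 i)//= fi.
have -> : bernoulli_weight s (upd f i false) = (1 - s) * W.
  rewrite /bernoulli_weight (bigD1 i)//= ffunE eqxx; congr (_ * _).
  by apply: eq_bigr => j /negbTE ji; rewrite ffunE ji.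
by ring.
Qed.

(** * Lower bound on the independent natural extension *)

Lemma indep_natural_extension_ge {R : realType} {n : nat} {X : 'I_n -> Type}
    (pi_ : forall i, X i -> R) (s : R) (a b : forall i, X i)
    (A : set (forall i, X i)) :
  (forall i x, 0 <= pi_ i x <= 1) -> 0 <= s <= 1 ->
  (forall i, pi_ i (a i) = s) -> (forall i, pi_ i (b i) = 1) -> A a ->
  s ^+ n <= indep_natural_extension (fun i => possibility_measure (pi_ i)) A.
Proof.
move=> pi01 s01 pia pib Aa.
apply: lb_le_inf.
  eexists; exists (fun _ _ => 0); last reflexivity.
  by move=> i; apply/bounded_funP; exists 0 => // x; rewrite normr0.
move=> _ [h hbd <-].
have /choice[M hM] i : exists M, 0 <= M /\ forall x, `|h i x| <= M.
  by have /bounded_funP[M ? ?] := hbd i; exists M.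
set U := fun i z => upper_expectation (possibility_measure (pi_ i))
  (fun x : X i => h i (dfwith z i x)).
set V := fun z => \1_A z - \sum_(i < n) (h i z - U i z).
pose z (f : {ffun 'I_n -> bool}) i := if f i then a i else b i.
have zupd f i v : dfwith (z f) i (if v then a i else b i) = z (upd f i v).
  apply: functional_extensionality_dep => j; rewrite /z ffunE eq_sym.
  by have [<-|ij] := eqVneq i j; [rewrite dfwithin|rewrite dfwithout].
(* [V] is bounded above: each upper expectation is at most [M i], as is [- h i]. *)
have Vle y : V y <= sup [set V z | z in setT].
  apply: (le_sup_mem _ (1 + \sum_(i < n) (M i + M i))); last by exists y.
  move=> _ [x _ <-]; rewrite /V lerD//.
  rewrite -sumrN; apply: ler_sum => i _; rewrite opprB addrC; apply: lerD.
    by rewrite (le_trans (ler_norm _))// normrN; case: (hM i).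
  have [M0 hiM] := hM i.
  rewrite -[leRHS]mulr1; apply: (upper_expectation_le _ setT) => //.
  - by apply: sup_le_nneg => // _ [t _ <-]; case/andP: (pi01 i t).
  - by move=> t _; rewrite (le_trans (ler_norm _)).
  - by move=> t /(_ I).
have w0 (f : {ffun 'I_n -> bool}) := bernoulli_weight_ge0 s f s01.
(* The weights sum to 1, so the supremum dominates the weighted average of [V] over the points
   [z f]. *)
rewrite -[leRHS]mul1r -(sum_bernoulli_weight 'I_n s) mulr_suml.
apply: (@le_trans _ _ (\sum_(f : {ffun 'I_n -> bool})
    bernoulli_weight s f * V (z f))); last first.
  by apply: ler_sum => f _; rewrite ler_wpM2l.
(* The expectation of [h i] in its own coordinate under the two-point law, which [U i] dominates. *)
pose mean i f := s * h i (z (upd f i true)) + (1 - s) * h i (z (upd f i false)).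
apply: (@le_trans _ _ (\sum_(f : {ffun 'I_n -> bool}) bernoulli_weight s f *
    (\1_A (z f) - \sum_(i < n) (h i (z f) - mean i f)))); last first.
  apply: ler_sum => f _; rewrite ler_wpM2l// /V lerB// ler_sum// => i _.
  rewrite lerB// /mean -(zupd f i true) -(zupd f i false)/= /U.
  have [_ hiM] := hM i.
  apply: (upper_expectation_two_point _ s (M i) (a i) (b i)
    (fun x => h i (dfwith (z f) i x))) => //.
  by move=> B; rewrite -(pia i); exact: two_point_poss.
under eq_bigr do rewrite mulrBr.
rewrite sumrB.
have -> : \sum_(f : {ffun 'I_n -> bool}) bernoulli_weight s f *
    \sum_(i < n) (h i (z f) - mean i f) = 0.
  under eq_bigr do rewrite mulr_sumr.
  rewrite exchange_big/= big1// => i _.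
  under eq_bigr do rewrite mulrBr.
  by rewrite sumrB (sum_bernoulli_weight_upd s i (fun f => h i (z f))) subrr.
(* Only the all-[true] configuration is kept: its point is [a], in [A], and its weight is
   [s ^+ n]. *)
rewrite subr0 (bigD1 [ffun=> true])//=.
have -> : z [ffun=> true] = a.
  by apply: functional_extensionality_dep => j; rewrite /z ffunE.
rewrite indicE mem_set// mulr1 /bernoulli_weight.
under eq_bigr do rewrite ffunE.
rewrite prodr_const card_ord lerDl; apply: sumr_ge0 => f _.
by rewrite mulr_ge0// ?w0// indicE ler0n.
Qed.

(** * Upper bound on the independent natural extension *)

Lemma indep_natural_extension_le {R : realType} {n : nat} {X : 'I_n -> Type}
    (pi_ : forall i, X i -> R) (s : R) (A : set (forall i, X i)) :
  0 <= s <= 1 -> (forall z, A z -> forall i, pi_ i (z i) <= s) ->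
  indep_natural_extension (fun i => possibility_measure (pi_ i)) A <= s ^+ n.
Proof.
move=> /andP[s0 s1] As.
set S := (X in inf X <= _).
have sn0 : 0 <= s ^+ n by exact: exprn_ge0.
(* Without a lower bound [inf] defaults to 0, which is at most [s ^+ n]. *)
have [Slb|nSlb] := pselect (has_lbound S); last first.
  by rewrite inf_out// => -[].
(* Indices start at 0, so [u i.+1] serves as the [i]-th function; [u 0] is the constant [s ^+ n] and
   [u n] the indicator of all coordinates being at level at most [s]. *)
pose u k (z : forall i, X i) : R :=
  s ^+ (n - k) * [forall j : 'I_n, (j < k)%N ==> (pi_ j (z j) <= s)]%:R.
have ubd k : bounded_fun (u k).
  apply/bounded_funP; exists 1 => // z.
  rewrite /u normrM ger0_norm ?exprn_ge0// mulr_ile1 ?exprn_ge0//.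
    by rewrite exprn_ile1.
  by case: [forall _, _]; rewrite /= ?normr1 ?normr0.
apply: (@le_trans _ _ (sup [set \1_A z - \sum_(i < n)
    (u i.+1 z - upper_expectation (possibility_measure (pi_ i))
      (fun x : X i => u i.+1 (dfwith z i x))) | z in setT])).
  apply: (ge_inf Slb).
  by exists (fun i : 'I_n => u i.+1) => // i; exact: ubd.
apply: sup_le_nneg => // _ [z _ <-].
apply: (@le_trans _ _ (\1_A z - \sum_(i < n) (u i.+1 z - u i z))).
  rewrite lerB// ler_sum// => i _; rewrite lerB//.
  pose B : set (X i) := [set x | pi_ i x <= s].
  (* The factor of [u i.+1] that is free of coordinate [i]; the possibility of [B] supplies the
     missing power of [s], and [u i z = c * s]. *)
  pose c := s ^+ (n - i.+1) *
    [forall j : 'I_n, (j < i)%N ==> (pi_ j (z j) <= s)]%:R.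
  have ij (j : 'I_n) : (j < i)%N -> i != j.
    by move=> ji; rewrite -val_eqE/= gtn_eqF.
  have uE x : u i.+1 (dfwith z i x) = c * (pi_ i x <= s)%R%:R.
    rewrite /u /c -mulrA -natrM mulnb; congr (_ * (nat_of_bool _)%:R).
    apply/forallP/andP => [uj|[/forallP uj xs] j].
      split; last by have := uj i; rewrite ltnSn dfwithin.
      apply/forallP => j; apply/implyP => ji.
      by have := uj j; rewrite ltnS (ltnW ji) dfwithout ?ij//.
    apply/implyP; rewrite ltnS leq_eqVlt => /orP[/eqP/val_inj ->|ji].
      by rewrite dfwithin.
    by have := uj j; rewrite ji dfwithout ?ij//.
  have c0 : 0 <= c by rewrite mulr_ge0 ?exprn_ge0 ?ler0n.
  have -> : u i z = c * s.
    by rewrite /u /c mulrAC -exprSr subnSK.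
  apply: (upper_expectation_le _ B) => //.
  - by apply: sup_le_nneg => // _ [x Bx <-].
  - by move=> x Bx; rewrite uE Bx mulr1.
  - by move=> x /negP/negbTE nBx; rewrite uE nBx mulr0.
rewrite -(big_mkord xpredT (fun i => u i.+1 z - u i z)) telescope_sumr//.
have -> : u 0 z = s ^+ n.
  by rewrite /u subn0; case: forallP => [|[]] => [|//]; rewrite mulr1.
(* What remains is [\1_A z <= u n z], which holds because [A] lies in the sublevel set. *)
rewrite lerBlDr addrC subrK /u subnn expr0 mul1r.
rewrite indicE; have [Az|_] := boolP (z \in A) => //.
case: forallP => // -[] i; apply/implyP => _.
by apply: As; exact: set_mem.
Qed.

(** * Upper probabilities of p-boxes *)

Lemma pbox_upper_ge0 {R : realType} {T : Type} (le : rel T) (F : T -> R)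
    (A : set T) : 0 <= pbox_upper le F A.
Proof. by apply: sup_nneg => _ [P [fP _] <-]; exact: finadd_ge0. Qed.

Lemma finadd_le_pbox_upper {R : realType} {T : Type} (le : rel T) (F : T -> R)
    (P : set T -> R) (A : set T) :
  finadd_probability P -> (forall x, P [set z | le z x] <= F x) ->
  P A <= pbox_upper le F A.
Proof.
move=> fP PF; apply: (le_sup_mem [set P A | P in _] 1).
  by move=> _ [P' [fP' _] <-]; exact: finadd_le1.
by exists P.
Qed.

Lemma pbox_upper_le1 {R : realType} {T : Type} (le : rel T) (F : T -> R)
    (A : set T) : pbox_upper le F A <= 1.
Proof.
by apply: sup_le_nneg => // _ [P [fP _] <-]; exact: finadd_le1.
Qed.

Lemma pbox_upper_le {R : realType} {T : Type} (le : rel T) (F : T -> R)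
    (x : T) : 0 <= F x -> pbox_upper le F [set z | le z x] <= F x.
Proof. by move=> F0; apply: sup_le_nneg => // _ [P [_ PF] <-]. Qed.

(** * Dominance and minimality of the induced distribution function *)

Theorem theorem29 (R : realType) (n : nat) (X : 'I_n -> Type)
    (pi_ : forall i : 'I_n, X i -> R)
    (n_ge1 : (1 <= n)%N)
    (pi_poss : forall i : 'I_n, possibility_distribution (pi_ i))
    (pi_range : forall i : 'I_n, range (pi_ i) = [set` `[0, 1]]) :
  let Pi := fun i : 'I_n => possibility_measure (pi_ i) in
  let le := maxposs_le pi_ in
  let pi := fun x : (forall i : 'I_n, X i) => maxposs pi_ x ^+ n in
  let Fbar := induced_cdf le pi in
  possibility_distribution pi /\
  is_cdf le Fbar /\
  dominates le Fbar (indep_natural_extension Pi) /\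
  forall G : (forall i : 'I_n, X i) -> R,
    is_cdf le G -> dominates le G (indep_natural_extension Pi) ->
    forall x : (forall i : 'I_n, X i), Fbar x <= G x.
Proof.
move=> Pi le pi Fbar.
have pi01 i x : 0 <= pi_ i x <= 1 by case: (pi_poss i).
have level r : 0 <= r <= 1 -> exists y, forall i, pi_ i (y i) = r.
  move=> r01; have lev i : exists y, pi_ i y = r.
    have : range (pi_ i) r by rewrite pi_range /= in_itv.
    by move=> [y _ <-]; exists y.
  by exists (fun i => sval (cid (lev i))) => i; exact: svalP (cid (lev i)).
pose Z := maxposs pi_.
have Z_ub x i : pi_ i (x i) <= Z x.
  by exact: (le_bigmax 0 (fun j => pi_ j (x j)) i).
have Z_le x r : 0 <= r -> (forall i, pi_ i (x i) <= r) -> Z x <= r.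
  by move=> r0 xr; apply/bigmax_leP.
have Z0 x : 0 <= Z x by rewrite /Z /maxposs bigmax_ge_id.
have Z01 x : 0 <= Z x <= 1.
  by rewrite Z0 Z_le// => i; case/andP: (pi01 i (x i)).
have Zlevel y r : 0 <= r -> (forall i, pi_ i (y i) = r) -> Z y = r.
  move=> r0 yr; apply/le_anti; rewrite Z_le//= => [|i]; last by rewrite yr.
  by rewrite -(yr (Ordinal n_ge1)).
have [t pit] : exists t, forall i, pi_ i (t i) = 1.
  by apply: level; rewrite ler01 lexx.
have Zt : Z t = 1 by exact: Zlevel.
have Fbar_eq x : Fbar x = Z x ^+ n.
  apply/le_anti/andP; split.
    apply: sup_le_nneg; first exact: exprn_ge0.
    by move=> _ [y yx <-]; apply: lerXn2r; rewrite ?nnegrE.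
  apply: (le_sup_mem (pi @` _) (Z x ^+ n)).
    by move=> _ [y yx <-]; apply: lerXn2r; rewrite ?nnegrE.
  by exists x => //; rewrite /= /le /maxposs_le.
have pw01 x : 0 <= Z x ^+ n <= 1.
  by case/andP: (Z01 x) => z0 z1; rewrite exprn_ge0// exprn_ile1.
split; [|split; [|split]].
- split=> //.
  apply/le_anti/andP; split.
    by apply: sup_le_nneg => // _ [y _ <-]; case/andP: (pw01 y).
  apply: (le_sup_mem (range pi) 1).
    by move=> _ [y _ <-]; case/andP: (pw01 y).
  by exists t => //; rewrite /pi -/(Z t) Zt expr1n.
- split=> [x|x y xy|]; rewrite ?Fbar_eq//.
    by apply: lerXn2r; rewrite ?nnegrE.
  exists t; last by rewrite Fbar_eq Zt expr1n.
  by move=> x; rewrite /le /maxposs_le -/(Z t) Zt; case/andP: (Z01 x).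
- move=> A; set p := pbox_upper _ _ _.
  have p0 : 0 <= p by exact: pbox_upper_ge0.
  have p1 : p <= 1 by exact: pbox_upper_le1.
  pose s := p `^ n%:R^-1.
  have s0 : 0 <= s by exact: powR_ge0.
  have sn : s ^+ n = p.
    rewrite -powR_mulrn// -powRrM mulVf ?powRr1//.
    by rewrite pnatr_eq0 -lt0n.
  have s1 : s <= 1 by rewrite -(@ler_pXn2r _ n)// ?nnegrE// sn expr1n.
  rewrite -sn; apply: indep_natural_extension_le; first by rewrite s0.
  move=> a Aa i; apply: (le_trans (Z_ub a i)).
  rewrite -(@ler_pXn2r _ n)// ?nnegrE// sn.
  apply: (@le_trans _ _ (two_point (Z a ^+ n) a t A)).
    case/andP: (pw01 a) => q0 q1.
    by rewrite /two_point indicE mem_set// mulr1 lerDl mulr_ge0 ?subr_ge0 ?indicE.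
  apply: finadd_le_pbox_upper; first exact: two_point_finadd.
  move=> x; rewrite Fbar_eq /two_point !indicE.
  case/andP: (pw01 a) => q0 q1; case/andP: (pw01 x) => r0 r1.
  (* If [[0, x]] contains [t], then [Fbar x = 1]; otherwise only the mass at [a] can count, and [a]
     below [x] gives [Z a <= Z x]. *)
  have [tx|tx] := boolP (t \in _).
    have -> : Z x ^+ n = 1.
      apply/le_anti; rewrite r1 -(expr1n _ n) lerXn2r ?nnegrE//.
      by move/set_mem: tx; rewrite /= /le /maxposs_le -/(Z t) Zt.
    by case: (_ \in _) => /=; lra.
  rewrite mulr0 addr0; have [ax|ax] := boolP (a \in _); last by rewrite mulr0.
  by rewrite mulr1 lerXn2r ?nnegrE//; move/set_mem: ax.
- move=> G [G01 _ _] Gdom x.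
  (* A point with all coordinates at level [Z x] lies in [[0, x]], so the extension gives that
     interval at least [Z x ^+ n], while the p-box of [G] gives it at most [G x]. *)
  have [a pia] := level _ (Z01 x).
  rewrite Fbar_eq; apply: (@le_trans _ _ (pbox_upper le G [set z | le z x])).
    apply: le_trans (Gdom _).
    apply: (indep_natural_extension_ge _ _ a t) => //.
    by rewrite /= /le /maxposs_le -/(Z a) (Zlevel _ _ (Z0 x) pia).
  by apply: pbox_upper_le; case/andP: (G01 x).
Qed.
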